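(* Let $X_i$, $i\ge 0$, be continua, and for $i\ge 1$ let $f_i,g_i\colon X_i\to X_{i-1}$ be continuous maps, with every $f_i$ surjective, satisfying for every $i\ge 1$: (i) $g_i\circ f_{i+1}=f_i\circ g_{i+1}$, and (ii) $g_{i+1}\circ f_{i+1}^{-1}=f_i^{-1}\circ g_i$ (as set-valued functions $X_i\to 2^{X_i}$). Let $X=\varprojlim(X_i,f_i)$ and let $\Psi\colon X\to X$ be the diagonal map $\Psi((x_0,x_1,x_2,\ldots))=(g_1(x_1),g_2(x_2),g_3(x_3),\ldots)$. Then $\mathrm{Ent}(g_i\circ f_i^{-1})\le\mathrm{Ent}(\Psi)$ for every $i\ge 1$. In particular, $\lim_{i\to\infty}\mathrm{Ent}(g_i\circ f_i^{-1})$ exists and $$\mathrm{Ent}(\Psi)=\lim_{i\to\infty}\mathrm{Ent}(g_i\circ f_i^{-1}).$$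
   Context: A continuum is a compact, connected, metric space. $\varprojlim(X_i,f_i)=\{(x_0,x_1,x_2,\ldots): f_i(x_i)=x_{i-1},\ i\ge 1\}\subset\prod_{i\ge 0}X_i$ with the product topology. The metric $d_i$ on $X_i$ has $\mathrm{diam}(X_i)=1$, and the metric on the inverse limit is $d(x,y)=\sum_{i\ge 0}d_i(x_i,y_i)/2^i$. For maps $f,g$, the set-valued functions $g\circ f^{-1}$ and $f^{-1}\circ g$ are $x\mapsto g(f^{-1}(\{x\}))$ and $x\mapsto f^{-1}(\{g(x)\})$. So $g_i\circ f_i^{-1}$ is a set-valued function from $X_{i-1}$ to itself. Set-valued functions and entropy. $2^X$ is the set of non-empty closed subsets of $X$. A set-valued function $F\colon X\to 2^X$ is assumed to have closed graph; a continuous map is regarded as a set-valued function with singleton values. An $n$-orbit of $F$ is a tuple $(x_1,\ldots,x_n)$ with $x_{i+1}\in F(x_i)$ for $1\le i<n$; $Orb_n(F)$ is the set of $n$-orbits. A set $S\subset Orb_n(F)$ is $(n,\varepsilon)$-separated if for any two distinct $(x_1,\ldots,x_n),(y_1,\ldots,y_n)\in S$ there is $i\in\{1,\ldots,n\}$ with $d_X(x_i,y_i)>\varepsilon$. Let $s_{n,\varepsilon}(F)$ be the largest cardinality of an $(n,\varepsilon)$-separated set. Then $\mathrm{Ent}(F)=\lim_{\varepsilon\to 0}\limsup_{n\to\infty}\frac1n\log s_{n,\varepsilon}(F)\in[0,\infty]$. *)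

(* Defs.v *)
From HB Require Import structures.
From mathcomp Require Import all_boot all_order all_algebra.
From mathcomp Require Import all_classical all_reals all_analysis.

Set Implicit Arguments.
Unset Strict Implicit.
Unset Printing Implicit Defensive.

Import Order.TTheory GRing.Theory Num.Theory.
Import numFieldNormedType.Exports.

Local Open Scope classical_set_scope.
Local Open Scope ring_scope.

Definition sv_comp_inv (A B C : Type) (g : A -> C) (f : A -> B) : B -> set C :=
  fun x => g @` (f @^-1` [set x]).

Definition sv_inv_comp (A B C : Type) (f : A -> B) (g : C -> B) : C -> set A :=
  fun x => f @^-1` [set g x].

(** Entropy is defined for a distance function [d] passed explicitly, so that
    it applies both to the metric of a [metricType] and to the weighted sum
    distance on an inverse limit. *)
Section entropy.
Context {R : realType} {T : Type} (d : T -> T -> R) (F : T -> set T).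

Definition n_orbits (n : nat) : set ('I_n -> T) :=
  [set x | forall i j : 'I_n, j = i.+1 :> nat -> F (x i) (x j)].

Definition eps_separated (n : nat) (e : R) (S : set ('I_n -> T)) : Prop :=
  forall x y, S x -> S y -> x <> y -> exists i : 'I_n, e < d (x i) (y i).

(** The largest cardinality of an (n, e)-separated set of n-orbits; it is [+oo]
    when separated sets of n-orbits of unbounded cardinality exist. *)
Definition sep_number (n : nat) (e : R) : \bar R :=
  ereal_sup [set (k%:R)%:E | k in
    [set k : nat | exists S : set ('I_n -> T),
      [/\ S `<=` @n_orbits n, eps_separated e S & (S #= `I_k)%card]]].

Definition growth_rate (e : R) : \bar R :=
  limn_esup (fun n : nat => ((n%:R^-1)%:E * lne (sep_number n e))%E).

Definition Ent : \bar R := lim (growth_rate e @[e --> 0^'+]).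

End entropy.

Definition continuum {R : realType} (T : metricType R) : Prop :=
  compact [set: T] /\ connected [set: T].

(** [sup] of an empty or unbounded set of reals is [0], so that [diam T = 1]
    entails that [T] is nonempty and bounded. *)
Definition diam {R : realType} (T : metricType R) : R :=
  sup [set r | exists x y : T, r = mdist x y].

(** Indices are shifted: [f i : X i.+1 -> X i] is the bonding map which is
    usually written [f_(i+1)]. *)
Section inverse_limit.
Context {R : realType} (X : nat -> metricType R).
Variable f : forall i, X i.+1 -> X i.

Definition invlim : Type :=
  {x : forall i, X i | forall i, f (x i.+1) = x i}.

Definition invlim_dist (x y : invlim) : R :=
  limn (series (fun i => mdist (sval x i) (sval y i) / 2 ^+ i)).

Variable g : forall i, X i.+1 -> X i.
Hypothesis fg : forall i, @g i \o @f i.+1 = @f i \o @g i.+1.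

Lemma diagonal_map_subproof (x : invlim) (i : nat) :
  f (g (sval x i.+2)) = g (sval x i.+1).
Proof. by rewrite -(svalP x i.+1); exact: (esym (congr1 (@^~ _) (fg i))). Qed.

Definition diagonal_map (x : invlim) : invlim :=
  exist _ (fun i => g (sval x i.+1)) (diagonal_map_subproof x).

End inverse_limit.

(* Main.v *)
Require Import Defs.
From HB Require Import structures.
From mathcomp Require Import all_boot all_order all_algebra.
From mathcomp Require Import all_classical all_reals all_analysis.
From mathcomp Require Import ring.

Set Implicit Arguments.
Unset Strict Implicit.
Unset Printing Implicit Defensive.

Import Order.TTheory GRing.Theory Num.Theory.
Import numFieldNormedType.Exports.

Local Open Scope classical_set_scope.
Local Open Scope ring_scope.

(* Write F_i for g_i o f_i^-1. Condition (ii) lets every n-orbit of F_i be lifted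
   along f_i to an n-orbit of F_(i+1), and iterating the lift yields an n-orbit
   of Psi lying over it; conversely each coordinate of an orbit of Psi is an
   orbit of F_i. Separation passes upwards by uniform continuity of f_i and since
   the distance of the limit dominates d_i / 2^i. It passes down to a single
   level N because a close N-th coordinate forces all the previous ones to be
   close, while the later ones contribute at most 2 / 2^N. Hence Ent F_i is
   nondecreasing with supremum Ent Psi. *)

(** * Upper limits and uniform continuity *)

Lemma le_limn_esup (R : realType) (u v : (\bar R)^nat) :
  (forall n, (u n <= v n)%E) -> (limn_esup u <= limn_esup v)%E.
Proof.
move=> uv; apply: le_ereal_inf_tmp => _ [V FV <-].
apply: ge_ereal_inf; exists (ereal_sup (u @` V)); first by exists V.
apply: ge_ereal_sup => _ [n Vn <-].
by apply: le_ereal_sup_tmp; exists (v n) => //; exists n.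
Qed.

(** Compactness is used as near-covering: a radius that works locally around each point then works
    for all points at once. The inequalities are non-strict so that the contrapositive carries
    strict separation from [f x], [f y] back to [x], [y]. *)
Lemma compact_mdist_unif_continuous (R : realType) (T U : metricType R)
    (f : T -> U) : compact [set: T] -> continuous f ->
  forall e : R, 0 < e -> exists2 d : R, 0 < d &
    forall x y, mdist x y <= d -> mdist (f x) (f y) <= e.
Proof.
move=> /compact_near_coveringP cT fc e e0.
pose P (d : R) (x : T) := forall y, mdist x y <= d -> mdist (f x) (f y) <= e.
have cover x : [set: T] x ->
    \forall x' \near x & d \near (0 : R)^'+, P d x'.
  move=> _.
  have e20 : 0 < e / 2 by rewrite divr_gt0.
  have /metricType_numDomainType.cvgrPdist_lt/(_ _ e20)/metricType_numDomainType.nbhs_mdistP[r /= r0 fr] := fc x.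
  have r20 : 0 < r / 2 by rewrite divr_gt0.
  exists ([set x' | mdist x x' < r / 2], [set d : R | d < r / 2]) => /=.
    split; last exact: nbhs_right_lt.
    by apply/metricType_numDomainType.nbhs_mdistP; exists (r / 2).
  move=> [x' d] /= [xx' dr] y x'y.
  have x'r : mdist x x' < r by rewrite (lt_trans xx')// ltr_pdivrMr// ltr_pMr// ltr1n.
  have yr : mdist x y < r.
    rewrite (le_lt_trans (metric_triangle _ x' _))// [r]splitr ltrD//.
    exact: le_lt_trans x'y dr.
  rewrite (le_trans (metric_triangle _ (f x) _))// [e]splitr lerD//.
    by rewrite metric_sym ltW// fr.
  by rewrite ltW// fr.
have nearP : \forall d \near (0 : R)^'+, [set: T] `<=` P d by exact: cT.
near (0 : R)^'+ => d; exists d => // x y.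
by apply: (_ : [set: T] `<=` P d) => //; near: d.
Unshelve. all: by end_near. Qed.

(** * Comparison of separation numbers and entropies *)

Section entropy_comparison.
Context {R : realType}.

Lemma sep_number_ge0 (T : Type) (d : T -> T -> R) (F : T -> set T) n e :
  (0 <= sep_number d F n e)%E.
Proof.
apply: ereal_sup_ubound; exists 0%N => //=; exists set0; split => //.
by rewrite II0.
Qed.

Lemma sep_number_nonincreasing (T : Type) (d : T -> T -> R) (F : T -> set T) n
    e e' : e <= e' -> (sep_number d F n e' <= sep_number d F n e)%E.
Proof.
move=> ee'; apply: ereal_sup_le => _ [k [S [SF Ssep Sk]] <-].
exists k => //; exists S; split => // x y Sx Sy xy.
by have [i xyi] := Ssep _ _ Sx Sy xy; exists i; exact: le_lt_trans xyi.
Qed.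

(** The common tool of all the entropy comparisons: orbits are moved along a relation [r] that
    preserves separation, so [r] can be a projection or the converse of one. *)
Lemma sep_number_transfer (T T' : Type) (d : T -> T -> R) (d' : T' -> T' -> R)
    (F : T -> set T) (F' : T' -> set T') (r : T -> T' -> Prop) n e e' :
  (forall x, n_orbits F x ->
    exists2 y : 'I_n -> T', n_orbits F' y & forall i, r (x i) (y i)) ->
  (forall a b a' b', r a a' -> r b b' -> e < d a b -> e' < d' a' b') ->
  (forall a, d' a a <= e') ->
  (sep_number d F n e <= sep_number d' F' n e')%E.
Proof.
move=> lift sep refl; apply: ereal_sup_le => _ [k [S [SF Ssep Sk]] <-].
(* The empty set is treated apart because the choice of [h] below needs a default tuple in [T'],
   here the image of some orbit in [S]. *)
exists k => //; have [S0|/set0P[x0 Sx0]] := eqVneq S set0.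
  exists set0; split => //; move: Sk; rewrite S0.
  by move=> /card_esym; rewrite card_eq0 => /eqP ->; rewrite card_eq0.
have [y0 _ _] := lift _ (SF _ Sx0).
have /choice[h hP] : forall x, exists y : 'I_n -> T',
    S x -> n_orbits F' y /\ forall i, r (x i) (y i).
  move=> x; have [Sx|nSx] := pselect (S x); last by exists y0.
  by have [y Fy xy] := lift _ (SF _ Sx); exists y.
have hsep x y : S x -> S y -> x <> y -> exists i, e' < d' (h x i) (h y i).
  move=> Sx Sy xy; have [i xyi] := Ssep _ _ Sx Sy xy; exists i.
  exact: sep ((hP _ Sx).2 i) ((hP _ Sy).2 i) xyi.
exists (h @` S); split.
- by move=> _ [x Sx <-]; exact: (hP _ Sx).1.
- by move=> _ _ [x Sx <-] [y Sy <-] hxy; apply: hsep => // xy; apply: hxy; rewrite xy.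
(* Separation makes [h] injective on [S]: equal images would be at distance more than [e'] from
   themselves. *)
- apply: card_eq_trans Sk; apply: inj_card_eq => x y /set_mem Sx /set_mem Sy hxy.
  apply: contrapT => xy; have [i] := hsep _ _ Sx Sy xy.
  by rewrite hxy ltNge refl.
Qed.

Lemma le_growth_rate (T T' : Type) (d : T -> T -> R) (d' : T' -> T' -> R)
    (F : T -> set T) (F' : T' -> set T') e e' :
  (forall n, (sep_number d F n e <= sep_number d' F' n e')%E) ->
  (growth_rate d F e <= growth_rate d' F' e')%E.
Proof.
move=> FF'; apply: le_limn_esup => n; apply: lee_wpmul2l.
  by rewrite lee_fin invr_ge0.
by rewrite lee_lne// in_itv/= leey sep_number_ge0.
Qed.

(** The growth rate can only increase as [e] decreases, so its limit at 0 from the right is a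
    supremum. *)
Lemma EntE (T : Type) (d : T -> T -> R) (F : T -> set T) :
  Ent d F = ereal_sup [set growth_rate d F e | e in `]0, +oo[].
Proof.
apply/cvg_lim => //; apply: nonincreasing_at_right_cvge => // e e' _ _ ee'.
by apply: le_growth_rate => n; exact: sep_number_nonincreasing.
Qed.

Lemma growth_rate_le_Ent (T : Type) (d : T -> T -> R) (F : T -> set T) e :
  0 < e -> (growth_rate d F e <= Ent d F)%E.
Proof.
move=> e0; rewrite EntE; apply: ereal_sup_ubound; exists e => //=.
by rewrite in_itv/= e0.
Qed.

Lemma Ent_le (T : Type) (d : T -> T -> R) (F : T -> set T) M :
  (forall e, 0 < e -> (growth_rate d F e <= M)%E) -> (Ent d F <= M)%E.
Proof.
move=> FM; rewrite EntE; apply: ge_ereal_sup => _ [e e0 <-].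
by apply: FM; move: e0; rewrite /= in_itv/= andbT.
Qed.

End entropy_comparison.

Lemma diam1_mdist_le1 (R : realType) (T : metricType R) (x y : T) :
  diam T = 1 -> mdist x y <= 1.
Proof.
rewrite /diam => T1; rewrite -T1; apply: sup_upper_bound; last by exists x, y.
(* If the set of distances had no supremum, [sup] would take its default value 0 instead of 1. *)
apply: contrapT => /sup_out; rewrite T1 => /eqP.
by rewrite oner_eq0.
Qed.

(** The exact value of the geometric sum is kept on the right so that the induction closes; the
    subtracted term is dropped in applications. *)
Lemma sum_half_le (R : realType) (a : nat -> R) c m n : (m <= n)%N ->
  (forall k, (m <= k < n)%N -> a k <= c) ->
  \sum_(m <= k < n) a k / 2 ^+ k <= c * (2 / 2 ^+ m - 2 / 2 ^+ n).
Proof.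
elim: n => [|n IH]; first by rewrite leqn0 => /eqP ->; rewrite big_geq// subrr mulr0.
rewrite leq_eqVlt => /predU1P[->|mn] ac; first by rewrite big_geq// subrr mulr0.
rewrite big_nat_recr//=.
have -> : c * (2 / 2 ^+ m - 2 / 2 ^+ n.+1) =
    c * (2 / 2 ^+ m - 2 / 2 ^+ n) + c / 2 ^+ n.
  have n0 : (2 : R) ^+ n != 0 by rewrite expf_neq0.
  have m0 : (2 : R) ^+ m != 0 by rewrite expf_neq0.
  by rewrite exprS; field; rewrite n0 m0.
apply: lerD.
  by apply: IH => // k /andP[mk kn]; apply: ac; rewrite mk ltnW.
by apply: ler_wpM2r; [rewrite invr_ge0 exprn_ge0|apply: ac; rewrite leqnn andbT].
Qed.

(* From a thread through one level, extend upwards by dependent choice and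
   downwards by induction on the level. *)
Lemma thread_through (A : nat -> Type) (Q : forall i, A i -> Prop)
    (r : forall i, A i -> A i.+1 -> Prop) :
  (forall i a, Q i a -> exists2 b, Q i.+1 b & r i a b) ->
  (forall i b, Q i.+1 b -> exists2 a, Q i a & r i a b) ->
  forall N a, Q N a -> exists u : forall i, A i,
    [/\ u N = a, forall i, Q i (u i) & forall i, r i (u i) (u i.+1)].
Proof.
move=> up down N; elim: N A Q r up down => [|N IH] A Q r up down a Qa.
  pose s i (p : {a | Q i a}) : {b | Q i.+1 b & r i (sval p) b} :=
    cid2 (up i _ (svalP p)).
  pose v := nat_rect (fun i => {a | Q i a}) (exist _ a Qa)
    (fun i p => exist _ (s2val (s i p)) (s2valP (s i p))).
  exists (fun i => sval (v i)); split => // i; first exact: svalP (v i).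
  exact: s2valP' (s i (v i)).
(* Shifting all families by one index puts the thread on levels 1 and above; [down] supplies level
   0. *)
have [u [uN Qu ru]] := IH (fun i => A i.+1) (fun i => Q i.+1) (fun i => r i.+1)
  (fun i => up i.+1) (fun i => down i.+1) a Qa.
have [a0 Qa0 ra0] := down 0%N _ (Qu 0%N).
by exists (fun i => if i is j.+1 then u j else a0); split => // -[].
Qed.

(** * The weighted distance on the inverse limit *)

Section inverse_limit_distance.
Context {R : realType} (X : nat -> metricType R) (f : forall i, X i.+1 -> X i).
Hypothesis X_le1 : forall i (x y : X i), mdist x y <= 1.

Let dterm (x y : invlim f) i := mdist (sval x i) (sval y i) / 2 ^+ i.

Let dterm_ge0 x y i : 0 <= dterm x y i.
Proof. by rewrite divr_ge0// ?exprn_ge0// mdist_ge0. Qed.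

Let series_nd x y : nondecreasing_seq (series (dterm x y)).
Proof. by apply: nondecreasing_series => n _ _; exact: dterm_ge0. Qed.

Let series_cvg x y : cvgn (series (dterm x y)).
Proof.
apply: nondecreasing_is_cvgn => //; exists 2 => _ [n _ <-].
rewrite /series/= (le_trans (sum_half_le (c := 1) _ _))//.
by rewrite mul1r expr0 divr1 gerBl divr_ge0// exprn_ge0.
Qed.

Lemma invlim_dist_ge (x y : invlim f) i :
  mdist (sval x i) (sval y i) / 2 ^+ i <= invlim_dist x y.
Proof.
apply: (@le_trans _ _ (series (dterm x y) i.+1)).
  rewrite /series/= big_nat_recr//= lerDr sumr_ge0// => k _; exact: dterm_ge0.
exact: nondecreasing_cvgn_le.
Qed.

Lemma invlim_dist_le (x y : invlim f) N c : 0 <= c ->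
  (forall k, (k < N)%N -> mdist (sval x k) (sval y k) <= c) ->
  invlim_dist x y <= c * 2 + 2 / 2 ^+ N.
Proof.
move=> c0 xyc; apply: limr_le; first exact: series_cvg.
exists N => // n /= Nn; rewrite /series/= (big_cat_nat (n := N))//=.
apply: lerD.
  rewrite (le_trans (sum_half_le (c := c) _ _))//.
  by rewrite ler_wpM2l// expr0 divr1 gerBl divr_ge0// exprn_ge0.
rewrite (le_trans (sum_half_le (c := 1) _ _))//.
by rewrite mul1r gerBl divr_ge0// exprn_ge0.
Qed.

Lemma invlim_distxx (x : invlim f) : invlim_dist x x = 0.
Proof.
rewrite /invlim_dist (_ : series _ = cst 0) ?lim_cst//.
by apply/funext => n; rewrite /series/= big1// => k _; rewrite mdistxx mul0r.
Qed.

Lemma invlim_coord_unif_continuous :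
  (forall i, compact [set: X i]) -> (forall i, continuous (@f i)) ->
  forall N (e : R), 0 < e -> exists2 d : R, 0 < d &
    forall x y : invlim f, mdist (sval x N) (sval y N) <= d ->
      forall k, (k <= N)%N -> mdist (sval x k) (sval y k) <= e.
Proof.
move=> cX fc N e e0; elim: N => [|N [d d0 IH]].
  by exists e => // x y xy k; rewrite leqn0 => /eqP ->.
have [d' d'0 fd'] := compact_mdist_unif_continuous (cX N.+1) (fc N) d0.
(* [d'] controls coordinates up to [N] through [f], while [e] controls coordinate [N.+1] itself. *)
exists (Num.min d' e); first by rewrite lt_min d'0.
move=> x y; rewrite le_min => /andP[xyd' xye] k.
rewrite leq_eqVlt => /predU1P[->//|]; apply: IH.
by rewrite -(svalP x N) -(svalP y N); exact: fd'.
Qed.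

End inverse_limit_distance.

(** * Lifting and projecting orbits *)

Section lifting_orbits.
Context {R : realType} (X : nat -> metricType R) (f g : forall i, X i.+1 -> X i).
Hypothesis f_surj : forall i (y : X i), exists x : X i.+1, f x = y.
Hypothesis fg_comm : forall i, @g i \o @f i.+1 = @f i \o @g i.+1.
Hypothesis fg_inv :
  forall i, sv_comp_inv (@g i.+1) (@f i.+1) = sv_inv_comp (@f i) (@g i).

Let F i : X i -> set (X i) := sv_comp_inv (@g i) (@f i).
Let Psi := fun x : invlim f => [set diagonal_map fg_comm x].

(** The first clause makes a tower of lifts a thread at each time; the second makes [Psi] send the
    thread at one time to the thread at the next. *)
Definition lift_of n i (u : 'I_n -> X i) (w : 'I_n -> X i.+1) : Prop :=
  (forall k, f (w k) = u k) /\
  (forall k l : 'I_n, l = k.+1 :> nat -> g (w k) = u l).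

(** The witnesses of the transitions of [u] form [w]; its last entry has no transition to witness
    and comes from surjectivity. Then [f (w l) = u l = g (w k)], which by (ii) is a transition of
    [w]. *)
Lemma orbit_lift n i (u : 'I_n -> X i) : n_orbits (@F i) u ->
  exists2 w, n_orbits (@F i.+1) w & lift_of u w.
Proof.
move=> Fu.
have /choice[w wP] : forall k : 'I_n, exists a : X i.+1,
    f a = u k /\ forall l : 'I_n, l = k.+1 :> nat -> g a = u l.
  move=> k; have [kn|kn] := ltnP k.+1 n.
    have [a /= fa ga] := Fu k (Ordinal kn) erefl; exists a; split => // l lk.
    by rewrite ga; congr u; exact: val_inj.
  have [a fa] := f_surj (u k); exists a; split => // l lk.
  by have := ltn_ord l; rewrite lk ltnNge kn.
exists w; last by split => k; [exact: (wP k).1|exact: (wP k).2].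
move=> k l lk; rewrite /F fg_inv /sv_inv_comp/=.
by rewrite (wP l).1 ((wP k).2 l).
Qed.

Lemma orbit_proj n i (w : 'I_n -> X i.+1) : n_orbits (@F i.+1) w ->
  exists2 u, n_orbits (@F i) u & lift_of u w.
Proof.
move=> Fw.
have gw (k l : 'I_n) : l = k.+1 :> nat -> g (w k) = f (w l).
  by move=> lk; have := Fw k l lk; rewrite /F fg_inv => /= ->.
exists (fun k => f (w k)) => //.
by move=> k l lk; exists (w k) => //; exact: gw.
Qed.

Lemma orbit_lift_invlim n N (u : 'I_n -> X N) : n_orbits (@F N) u ->
  exists2 z : 'I_n -> invlim f, n_orbits Psi z & forall k, sval (z k) N = u k.
Proof.
move=> Fu.
have [v [vN _ vP]] := thread_through
  (A := fun i => 'I_n -> X i) (Q := fun i u => n_orbits (@F i) u) (r := @lift_of n)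
  (@orbit_lift n) (@orbit_proj n) Fu.
(* The thread of orbits is transposed into an orbit of threads. *)
pose z (k : 'I_n) : invlim f :=
  exist (fun x : forall i, X i => forall i, f (x i.+1) = x i)
    (fun i => v i k) (fun i => (vP i).1 k).
exists z; last by move=> k /=; rewrite vN.
move=> k l lk; rewrite /Psi/=; apply: eq_exist => /=.
by apply: functional_extensionality_dep => i; apply: esym; exact: (vP i).2.
Qed.

Lemma orbit_proj_invlim n N (z : 'I_n -> invlim f) : n_orbits Psi z ->
  n_orbits (@F N) (fun k => sval (z k) N).
Proof.
move=> Pz k l lk; have /= -> := Pz k l lk.
by exists (sval (z k) N.+1) => //=; exact: (svalP (z k) N).
Qed.

End lifting_orbits.

Theorem proposition3p5 (R : realType) (X : nat -> metricType R)
    (f g : forall i : nat, X i.+1 -> X i)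
    (X_continuum : forall i, continuum (X i))
    (X_diam : forall i, diam (X i) = 1)
    (f_cont : forall i, continuous (f i))
    (g_cont : forall i, continuous (g i))
    (f_surj : forall i (y : X i), exists x : X i.+1, f i x = y)
    (fg_comm : forall i, g i \o f i.+1 = f i \o g i.+1)
    (fg_inv : forall i, sv_comp_inv (g i.+1) (f i.+1) = sv_inv_comp (f i) (g i)) :
  let EntF (i : nat) : \bar R := Ent mdist (sv_comp_inv (g i) (f i)) in
  let EntPsi : \bar R :=
    Ent (@invlim_dist R X f) (fun x => [set diagonal_map fg_comm x]) in
  [/\ forall i, (EntF i <= EntPsi)%E,
      cvgn EntF
    & EntPsi = limn EntF].
Proof.
move=> EntF EntPsi.
have X_le1 i (x y : X i) : mdist x y <= 1 by exact: diam1_mdist_le1.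
have X_compact i : compact [set: X i] by case: (X_continuum i).
have F_Psi i : (EntF i <= EntPsi)%E.
  apply: Ent_le => e e0.
  (* Coordinate [i] enters the limit distance with weight [1 / 2 ^+ i]. *)
  have e'0 : 0 < e / 2 ^+ i by rewrite divr_gt0// exprn_gt0.
  apply: le_trans (growth_rate_le_Ent _ _ e'0); apply: le_growth_rate => n.
  apply: (sep_number_transfer (r := fun a (z : invlim f) => sval z i = a)).
  - by move=> u /(orbit_lift_invlim f_surj fg_comm fg_inv).
  - move=> a b z z' <- <- ab; apply: lt_le_trans (invlim_dist_ge X_le1 _ _ i).
    by rewrite ltr_pM2r// invr_gt0 exprn_gt0.
  - by move=> z; rewrite invlim_distxx ltW.
have F_nd : nondecreasing_seq EntF.
  apply/nondecreasing_seqP => i; apply: Ent_le => e e0.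
  have [d d0 fd] := compact_mdist_unif_continuous (X_compact i.+1) (f_cont i) e0.
  apply: le_trans (growth_rate_le_Ent _ _ d0); apply: le_growth_rate => n.
  apply: (sep_number_transfer (r := fun a b => f i b = a)).
  - by move=> u /(orbit_lift f_surj fg_inv)[w Fw [fw _]]; exists w.
  - move=> a b a' b' <- <-; rewrite !ltNge; apply: contra; exact: fd.
  - by move=> a; rewrite mdistxx ltW.
have F_cvg := ereal_nondecreasing_cvgn F_nd.
split; [exact: F_Psi|by apply/cvg_ex; eexists; exact: F_cvg|].
(* By monotonicity the limit is the supremum, so only the upper bound on [EntPsi] needs work. *)
rewrite (cvg_lim _ F_cvg)//; apply/eqP; rewrite eq_le; apply/andP; split; last first.
  by apply: ge_ereal_sup => _ [i _ <-].
apply: Ent_le => e e0.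
(* With this [N], [4 / e < 2 ^+ N]: the tail costs at most [e / 2], and closeness [e / 4] of the
   earlier coordinates costs another [e / 2]. *)
pose N := Num.bound (4 / e).
have N_tail : 2 / 2 ^+ N <= e / 2.
  have := upper_nthrootP (leqnn N); rewrite ltr_pdivrMr// => /ltW eN.
  rewrite ler_pdivrMr ?exprn_gt0// mulrAC ler_pdivlMr//.
  by rewrite mulrC [_ * 2 ^+ _]mulrC -natrM.
have e40 : 0 < e / 4 by rewrite divr_gt0.
have [d d0 coordN] := invlim_coord_unif_continuous X_compact f_cont N e40.
apply: (@le_trans _ _ (EntF N)); last by apply: ereal_sup_ubound; exists N.
apply: le_trans (growth_rate_le_Ent _ _ d0); apply: le_growth_rate => n.
apply: (sep_number_transfer (r := fun (z : invlim f) a => sval z N = a)).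
- move=> z /(orbit_proj_invlim N) Fz.
  by exists (fun k => sval (z k) N).
- move=> z z' _ _ <- <-; rewrite !ltNge; apply: contra => zz'.
  apply: (le_trans (invlim_dist_le X_le1 (N := N) (ltW e40) _)).
    by move=> k kN; apply: coordN zz' _ (ltnW kN).
  apply: (le_trans (lerD (lexx _) N_tail)).
  by rewrite le_eqVlt; apply/orP; left; apply/eqP; field.
- by move=> a; rewrite mdistxx ltW.
Qed.
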